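(* Let $(X_n,*_{X_n})$, $n\in\omega$, be pointed topological spaces such that each $X_n$ has the strong Pytkeev property at its distinguished point $*_{X_n}$. Then the Tychonoff bouquet $\coprod_{n\in\omega}X_n$ and the Tychonoff product $\prod_{n\in\omega}X_n$ both have the strong Pytkeev property at their distinguished point $( *_{X_n})_{n\in\omega}$.
   Context: A subset $A$ of a topological space $X$ accumulates at a point $x\in X$ if each neighborhood of $x$ contains infinitely many points of $A$. A topological space $X$ has the strong Pytkeev property at a point $x\in X$ if there is a countable family $\mathcal N$ of subsets of $X$ such that for every neighborhood $O_x\subset X$ of $x$ and every subset $A\subset X$ accumulating at $x$ there is a set $N\in\mathcal N$ such that $N\subset O_x$ and $N\cap A$ is infinite. A pointed space is a topological space $X$ with a distinguished point $*_X$. The Tychonoff product $\prod_{n\in\omega}X_n$ (with the product topology) has distinguished point $( *_{X_n})_{n\in\omega}$. The Tychonoff bouquet $\coprod_{n\in\omega}X_n$ is the subspace $\{(x_n)_{n\in\omega}\in\prod_{n\in\omega}X_n: |\{n\in\omega:x_n\ne *_{X_n}\}|\le 1\}$ of the Tychonoff product. *)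

(* Defs.v *)
From HB Require Import structures.
From mathcomp Require Import all_boot all_order all_algebra.
From mathcomp Require Import all_classical all_reals all_analysis.

Set Implicit Arguments.
Unset Strict Implicit.
Unset Printing Implicit Defensive.

Local Open Scope classical_set_scope.
Local Open Scope card_scope.

Definition accumulation_at (X : topologicalType) (A : set X) (x : X) : Prop :=
  forall U : set X, nbhs x U -> infinite_set (U `&` A).

Definition strong_Pytkeev_at (X : topologicalType) (x : X) : Prop :=
  exists N : set (set X), countable N /\
    forall (O A : set X), nbhs x O -> accumulation_at A x ->
      exists F : set X, [/\ N F, F `<=` O & infinite_set (F `&` A)].

Definition bouquet (X : nat -> topologicalType) (p : forall n, X n) :
    set (prod_topology X) :=
  [set x | [set n | x n <> p n] #<= `I_1].

Lemma bouquet_base (X : nat -> topologicalType) (p : forall n, X n) :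
  (p : prod_topology X) \in bouquet p.
Proof.
apply/mem_set; rewrite /bouquet /=.
suff -> : [set n | p n <> p n] = set0 by exact: card_ge0.
by apply/seteqP; split=> n //=; apply.
Qed.

(* [set_type] carries the topology induced by the inclusion, unlike the
   library's [subspace], which keeps the ambient carrier. *)
Definition tychonoff_bouquet (X : nat -> topologicalType)
    (p : forall n, X n) : topologicalType := set_type (bouquet p).

Definition bouquet_point (X : nat -> topologicalType) (p : forall n, X n) :
    tychonoff_bouquet p :=
  exist _ (p : prod_topology X) (bouquet_base p).

(* Main.v *)
Require Import Defs.
From HB Require Import structures.
From mathcomp Require Import all_boot all_order all_algebra.
From mathcomp Require Import all_classical all_reals all_analysis.

(** The strong Pytkeev property at a point only speaks of the filter of its
    neighborhoods, so it makes sense along an arbitrary filter on a set.  The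
    neighborhood filter of the product is generated by the pullbacks of the
    neighborhood filters of the factors along the projections, and the one of
    the bouquet is the pullback of that filter along the inclusion.  It thus
    suffices that the property survives three constructions on filters.

    - Pullback along a map [f] ([strong_Pytkeev_pullback]).  The sets
      [f @^-1` P], with [P] in the given family, do the job as long as the
      image of [A] still accumulates; this fails only when [A] has infinitely
      many points over the intersection [K] of all sets of the filter, so
      [f @^-1` K] is added to the family.

    - Join of two filters ([strong_Pytkeev_join]).  The sets [P `&` Q] do the
      job.  Enumerate those [P] and [Q] that are small enough, and let [f n]
      and [g n] be the unions of those enumerated up to stage [n].  If every
      [f n `&` g n `&` A] is finite, cut [A] into the points that enter the
      sequence [g] no later than [f] and the points that enter [f] no later
      than [g].  The first part meets each [f n] only inside [f n `&` g n],
      hence in a finite set, and so it does not accumulate along the first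
      filter; symmetrically for the second part.  Hence [A] does not
      accumulate along the join.

    - Countable unions ([strong_Pytkeev_bigcup]).  An infinite join is the
      union of the finite ones, and accumulating along the union implies
      accumulating along each of its members, so the union of the families
      works. *)

Set Implicit Arguments.
Unset Strict Implicit.
Unset Printing Implicit Defensive.

Local Open Scope classical_set_scope.
Local Open Scope card_scope.

(** * The strong Pytkeev property along a filter *)

Definition accumulation_along {T : Type} (A : set T) (F : set_system T) :
  Prop := forall U, F U -> infinite_set (U `&` A).

Definition strong_Pytkeev_along {T : Type} (F : set_system T) : Prop :=
  exists N : set (set T), countable N /\
    forall O A, F O -> accumulation_along A F ->
      exists P, [/\ N P, P `<=` O & infinite_set (P `&` A)].

Definition pullback {S T : Type} (f : S -> T) (F : set_system T) :
  set_system S := filter_from F (fun U => f @^-1` U).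

Definition join {T : Type} (F G : set_system T) : set_system T :=
  filter_from (F `*` G) (fun UV => UV.1 `&` UV.2).

Lemma pullback_filter {S T : Type} (f : S -> T) (F : set_system T) :
  Filter F -> Filter (pullback f F).
Proof.
move=> FF; apply: filter_from_filter; first by exists setT; exact: filterT.
by move=> U V FU FV; exists (U `&` V) => //; exact: filterI.
Qed.

Lemma join_filter {T : Type} (F G : set_system T) :
  Filter F -> Filter G -> Filter (join F G).
Proof.
move=> FF FG; apply: filter_from_filter.
  by exists (setT, setT); split; exact: filterT.
move=> [U V] [U' V'] [/= FU GV] [/= FU' GV'].
exists (U `&` U', V `&` V'); first by split; exact: filterI.
by move=> x /= [[? ?] [? ?]].
Qed.

(** * Pullbacks *)

Lemma filter_avoid_finite {T : choiceType} (F : set_system T) (D : set T) :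
  Filter F -> finite_set D -> D `&` \bigcap_(U in F) U = set0 ->
  exists2 U, F U & U `&` D = set0.
Proof.
move=> FF /finite_seqP[s ->] sK.
have {sK} sK x : x \in s -> exists2 U, F U & ~ U x.
  move=> xs; apply: contrapT => noU.
  suff: ([set` s] `&` \bigcap_(U in F) U) x by rewrite sK.
  by split=> // U FU; apply: contrapT => nUx; apply: noU; exists U.
elim: s sK => [_|x s IHs sK].
  by exists setT; [exact: filterT | rewrite set_nil setI0].
have [U FU Us] : exists2 U, F U & U `&` [set` s] = set0.
  by apply: IHs => y ys; apply: sK; rewrite in_cons ys orbT.
have [V FV nVx] := sK x (mem_head x s).
exists (U `&` V); first exact: filterI.
apply/seteqP; split=> // y [[Uy Vy]] /=.
rewrite in_cons => /orP[/eqP yx|ys]; first by rewrite yx in Vy.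
by suff: (U `&` [set` s]) y by rewrite Us.
Qed.

(** No separation is assumed, so the intersection [K] of the sets of [F] may
    be large.  A set with infinitely many points over [K] is dealt with by the
    extra set [f @^-1` K]; otherwise the points over [K] can be discarded, and
    the image of the rest accumulates along [F], because a finite set disjoint
    from [K] is avoided by some set of [F]. *)
Lemma strong_Pytkeev_pullback {S : Type} {T : choiceType} (f : S -> T)
    (F : set_system T) :
  Filter F -> strong_Pytkeev_along F -> strong_Pytkeev_along (pullback f F).
Proof.
move=> FF [N [cN PN]]; pose K := \bigcap_(U in F) U.
exists ((fun P => f @^-1` P) @` (N `|` [set K])); split.
  apply: sub_countable (card_image_le _ _) _.
  by rewrite -bigcup2E; apply: bigcup_countable => // -[|[|i]] _ //=.
move=> O A [U FU fUO] accA.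
have [finKA|] := pselect (finite_set (f @^-1` K `&` A)); last first.
  exists (f @^-1` K); split=> //; first by exists K => //; right.
  by move=> s Kfs; apply: fUO; exact: Kfs.
pose B := f @` (A `\` f @^-1` K).
have accB : accumulation_along B F.
  move=> V FV finVB.
  have [|W FW WVB] := filter_avoid_finite FF finVB.
    by rewrite -subset0 => x [[_ [s [_ nKs] <-]] Ks]; exact: nKs.
  have /accA : pullback f F (f @^-1` (V `&` W)).
    by exists (V `&` W) => //; exact: filterI.
  apply; apply: sub_finite_set finKA => s [[Vfs Wfs] As]; split=> //.
  apply: contrapT => nKs.
  suff: (W `&` (V `&` B)) (f s) by rewrite WVB.
  by split=> //; split=> //; exists s.
have [P [NP PU infPB]] := PN U B FU accB.
exists (f @^-1` P); split.
- by exists P => //; left.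
- by move=> s Pfs; apply: fUO; exact: PU.
- apply: contra_not infPB => /(finite_image f); apply: sub_finite_set.
  by move=> y [Py [s [As _] fs]]; exists s => //; split=> //=; rewrite fs.
Qed.

(** * Joins of two filters *)

Lemma finite_below {T : Type} (N : set T) (c : T -> nat) (n : nat) :
  {in N &, injective c} -> finite_set (N `&` [set t | (c t <= n)%N]).
Proof.
move=> cinj.
have : c @` (N `&` [set t | (c t <= n)%N]) #= N `&` [set t | (c t <= n)%N].
  by apply: inj_card_eq => s t; rewrite !inE => -[Ns _] [Nt _];
    apply: cinj; rewrite inE.
move=> /eq_finite_set <-; apply: (@sub_finite_set _ _ `I_n.+1).
  by move=> _ [t [_ /= ctn] <-].
exact: finite_II.
Qed.

(** The two families are compared through enumerations: a point of [A] caught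
    by stage [n] of one enumeration, and caught by the other one no later,
    lies in one of finitely many sets [P `&` Q].  Each point of [A] is of this
    kind for one of the two orders, or is caught by neither enumeration, since
    the stages increase. *)
Lemma strong_Pytkeev_join {T : Type} (F G : set_system T) :
  strong_Pytkeev_along F -> strong_Pytkeev_along G ->
  strong_Pytkeev_along (join F G).
Proof.
move=> [N [cN PN]] [M [cM PM]].
exists ((fun PQ => PQ.1 `&` PQ.2) @` (N `*` M)); split.
  by apply: sub_countable (card_image_le _ _) _; exact: countableX.
move=> O A [[U V] [/= FU GV] UVO] accA.
apply: contrapT => noPQ.
have finPQ P Q : N P -> P `<=` U -> M Q -> Q `<=` V ->
    finite_set (P `&` Q `&` A).
  move=> NP PU MQ QV; apply: contrapT => infPQ; apply: noPQ.
  exists (P `&` Q); split=> //; first by exists (P, Q).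
  by move=> x [Px Qx]; apply: UVO; split; [exact: PU|exact: QV].
have /countable_injP[c cinj] := cN; have /countable_injP[d dinj] := cM.
pose Ni n := [set P | [/\ N P, P `<=` U & (c P <= n)%N]].
pose Mi n := [set Q | [/\ M Q, Q `<=` V & (d Q <= n)%N]].
pose f n := \bigcup_(P in Ni n) P; pose g n := \bigcup_(Q in Mi n) Q.
have fin_fg n : finite_set (f n `&` g n `&` A).
  apply: (@sub_finite_set _ _
    (\bigcup_(PQ in Ni n `*` Mi n) (PQ.1 `&` PQ.2 `&` A))).
    by move=> x [[[P NiP Px] [Q MiQ Qx]] Ax]; exists (P, Q).
  apply: bigcup_finite => [|[P Q] [/= [NP PU _] [MQ QV _]]]; last exact: finPQ.
  apply: finite_setX.
    by apply: sub_finite_set (finite_below n cinj) => P [].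
  by apply: sub_finite_set (finite_below n dinj) => Q [].
(* If the points entering [g] no later than [f] did accumulate along [F],
   some [P] would contain infinitely many of them, all in the finite set
   [f (c P) `&` g (c P) `&` A]. *)
have [W1 FW1 fin1] : exists2 W, F W &
    finite_set (W `&` (A `&` [set x | forall n, f n x -> g n x])).
  apply: contrapT => noW.
  have [||P [NP PU]] := PN U (A `&` [set x | forall n, f n x -> g n x]) => //.
    by move=> W FW finW; apply: noW; exists W.
  apply; apply: sub_finite_set (fin_fg (c P)) => x [Px [Ax fgx]].
  have fx : f (c P) x by exists P.
  by split=> //; split=> //; exact: fgx.
have [W2 GW2 fin2] : exists2 W, G W &
    finite_set (W `&` (A `&` [set x | forall n, g n x -> f n x])).
  apply: contrapT => noW.
  have [||Q [MQ QV]] := PM V (A `&` [set x | forall n, g n x -> f n x]) => //.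
    by move=> W GW finW; apply: noW; exists W.
  apply; apply: sub_finite_set (fin_fg (d Q)) => x [Qx [Ax gfx]].
  have gx : g (d Q) x by exists Q.
  by split=> //; split=> //; exact: gfx.
have /accA : join F G (W1 `&` W2) by exists (W1, W2).
apply; move: (conj fin1 fin2); rewrite -finite_setU; apply: sub_finite_set.
move=> x [[W1x W2x] Ax].
(* A failure at stage [m] puts [x] in [f m] but not in [g m]: then [x] is in
   [f n] for [n >= m], and is not in [g n] for [n < m]. *)
have [fgx|] := pselect (forall n, f n x -> g n x); first by left.
move=> /existsNP[m /not_implyP[fmx ngmx]]; right; split=> //; split=> //= n gnx.
have [mn|/ltnW nm] := leqP m n.
  have [P [NP PU cP] Px] := fmx.
  by exists P => //; split=> //; exact: leq_trans mn.
have [Q [MQ QV dQ] Qx] := gnx; case: ngmx.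
by exists Q => //; split=> //; exact: leq_trans nm.
Qed.

(** * Countable joins *)

Lemma strong_Pytkeev_bigcup {T : Type} (F : nat -> set_system T) :
  (forall k, strong_Pytkeev_along (F k)) ->
  strong_Pytkeev_along (\bigcup_k F k).
Proof.
move=> /choice[N PN]; exists (\bigcup_k N k); split.
  by apply: bigcup_countable => // k _; have [] := PN k.
move=> O A [k _ FkO] accA; have [_ /(_ O A FkO)[|P [NkP PO infPA]]] := PN k.
  by move=> U FkU; apply: accA; exists k.
by exists P; split=> //; exists k.
Qed.

Fixpoint joins {T : Type} (F : nat -> set_system T) (k : nat) : set_system T :=
  if k is k'.+1 then join (joins F k') (F k) else F 0%N.

Lemma strong_Pytkeev_joins {T : Type} (F : nat -> set_system T) (k : nat) :
  (forall n, strong_Pytkeev_along (F n)) -> strong_Pytkeev_along (joins F k).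
Proof. by move=> PF; elim: k => //= k IHk; exact: strong_Pytkeev_join. Qed.

Lemma joins_filter {T : Type} (F : nat -> set_system T) (k : nat) :
  (forall n, Filter (F n)) -> Filter (joins F k).
Proof. by move=> FF; elim: k => //= k IHk; exact: join_filter. Qed.

Lemma sub_joins {T : Type} (F : nat -> set_system T) (k : nat) :
  (forall n, Filter (F n)) -> F k `<=` joins F k.
Proof.
move=> FF; case: k => [//|k] U FU; exists (setT, U); last by move=> x [].
by have FFk := joins_filter k FF; split=> //; exact: filterT.
Qed.

Lemma joinsS {T : Type} (F : nat -> set_system T) (j k : nat) :
  (forall n, Filter (F n)) -> (j <= k)%N -> joins F j `<=` joins F k.
Proof.
move=> FF /subnK<-; elim: (k - j)%N => [//|i IHi] U /IHi jU.
by exists (U, setT); [split=> //; exact: filterT | move=> x []].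
Qed.

Lemma bigcup_joins_filter {T : Type} (F : nat -> set_system T) :
  (forall n, Filter (F n)) -> Filter (\bigcup_k joins F k).
Proof.
move=> FF; split.
- by exists 0%N => //; exact: filterT.
- move=> U V [j _ jU] [k _ kV]; exists (maxn j k) => //.
  have FFjk := joins_filter (maxn j k) FF; apply: filterI.
    by apply: (joinsS FF) jU; exact: leq_maxl.
  by apply: (joinsS FF) kV; exact: leq_maxr.
- move=> U V UV [k _ kU]; exists k => //.
  by have FFk := joins_filter k FF; exact: filterS kU.
Qed.

Lemma joins_sub {T : Type} (F : nat -> set_system T) (G : set_system T)
    (k : nat) :
  Filter G -> (forall n, F n `<=` G) -> joins F k `<=` G.
Proof.
move=> FG sFG; elim: k => [|k IHk]; first exact: sFG.
move=> O [[U V] [/= /IHk GU /sFG GV] UVO].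
by apply: filterS UVO _; exact: filterI.
Qed.

(** * Neighborhoods in products and bouquets *)

Lemma nbhs_initial {S : choiceType} {T : topologicalType} (f : S -> T)
    (s : S) :
  nbhs (s : initial_topology f) = pullback f (nbhs (f s)).
Proof.
apply/seteqP; split=> O; last first.
  by move=> [U fsU UO]; apply: filterS UO _; exact: initial_continuous.
rewrite nbhsE => -[_ [[V oV <-] Vfs] VO].
by exists V => //; exists V.
Qed.

(** The product topology is the supremum of the initial topologies of the
    projections: a filter converges to [p] as soon as it contains the pullback
    of each neighborhood filter, and the union of the finite joins is the
    least such filter. *)
Lemma nbhs_prod (X : nat -> topologicalType) (p : forall n, X n) :
  nbhs (p : prod_topology X) =
  \bigcup_k joins (fun n => pullback (proj n) (nbhs (p n))) k.
Proof.
pose F n : set_system (prod_topology X) := pullback (proj n) (nbhs (p n)).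
have FF n : Filter (F n) by exact: pullback_filter.
apply/seteqP; split; last first.
  apply: bigcup_sub => k _; apply: joins_sub => n O [U pU UO].
  by apply: filterS UO _; exact: proj_continuous.
have FG : Filter (\bigcup_k joins F k) by exact: bigcup_joins_filter.
suff : (\bigcup_k joins F k : set_system (prod_topology X)) -->
    (p : prod_topology X) by [].
apply/cvg_sup => n O; rewrite [nbhs _]nbhs_initial => FnO.
by exists n => //; exact: sub_joins.
Qed.

Theorem theorem3p1 (X : nat -> topologicalType) (p : forall n : nat, X n)
    (hX : forall n : nat, strong_Pytkeev_at (p n)) :
  strong_Pytkeev_at (bouquet_point p) /\
  strong_Pytkeev_at (p : prod_topology X).
Proof.
have Pprod : strong_Pytkeev_along (nbhs (p : prod_topology X)).
  rewrite nbhs_prod; apply: strong_Pytkeev_bigcup => k.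
  apply: strong_Pytkeev_joins => n; exact: strong_Pytkeev_pullback (hX n).
split; last exact: Pprod.
suff : strong_Pytkeev_along (nbhs (bouquet_point p)) by [].
rewrite [nbhs _]nbhs_initial.
exact: strong_Pytkeev_pullback.
Qed.
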